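(* Let $\mathbb{K}$ be a field of characteristic $p>2$ and let $u$ be the restricted enveloping algebra of $\mathfrak{sl}_2$ over $\mathbb{K}$, i.e. the associative unital $\mathbb{K}$-algebra generated by $\mathsf{E},\mathsf{F},\mathsf{H}$ subject to $$\mathsf{H}\mathsf{E}-\mathsf{E}\mathsf{H}=2\mathsf{E},\quad \mathsf{H}\mathsf{F}-\mathsf{F}\mathsf{H}=-2\mathsf{F},\quad \mathsf{E}\mathsf{F}-\mathsf{F}\mathsf{E}=\mathsf{H},\quad \mathsf{E}^p=\mathsf{F}^p=\mathsf{H}^p-\mathsf{H}=0.$$ Then $u$ is a relative cellular algebra with the following cell datum $(X,M,C,{}^{\star},E,O,\underline{\varepsilon})$, where the set $\{0,1,\dots,p-1\}$ is identified with the prime field $\mathbb{F}_p$: - $X=\{0,1,\dots,p-1\}$ and $M(\lambda)=\{0,1,\dots,p-1\}$ for all $\lambda\in X$; - $C^{\lambda}_{S,T}=\mathsf{F}^{S}1_{\lambda}\mathsf{E}^{T}$ for $\lambda\in X$, $S,T\in M(\lambda)$, where $1_{\lambda}=-\prod_{\mu\in\mathbb{F}_p,\mu\neq\lambda}(\mathsf{H}-\mu)$; - ${}^{\star}$ is the anti-involution with $(\mathsf{F}^{S}1_{\lambda}\mathsf{E}^{T})^{\star}=\mathsf{F}^{T}1_{\lambda}\mathsf{E}^{S}$; - $E=\{1_{\lambda}\mid\lambda\in X\}$; - $O=\{<_{1_{\lambda}}\mid\lambda\in X\}$, where $<_{1_{\lambda}}$ is the total order on $X$ given by $\lambda+2(p-1)<_{1_{\lambda}}\cdots<_{1_{\lambda}}\lambda+4<_{1_{\lambda}}\lambda+2<_{1_{\lambda}}\lambda$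 (all entries read modulo $p$); - $\underline{\varepsilon}(S)=\varepsilon_S=1_{\lambda-2S}$ for $S\in M(\lambda)$ (index read modulo $p$).
   Context: Conventions: algebras and maps are over $\mathbb{K}$; idempotents are non-zero. Relative cellular algebra. An associative algebra $R$ together with a (relative) cell datum $(X,M,C,{}^{\star},E,O,\underline{\varepsilon})$ such that: (a) $X$ is a set, $M=\{M(\lambda)\mid\lambda\in X\}$ is a collection of finite non-empty sets (elements of $M(\lambda)$ for different $\lambda$ are regarded as distinct), and $C\colon\coprod_{\lambda\in X}M(\lambda)\times M(\lambda)\to R$ is an injective map whose image is a basis of $R$; write $C(S,T)=C^{\lambda}_{S,T}$ for $S,T\in M(\lambda)$. (b) ${}^{\star}\colon R\to R$ is an anti-involution with $(C^{\lambda}_{S,T})^{\star}=C^{\lambda}_{T,S}$. (c) $E$ is a set of pairwise orthogonal idempotents with $\varepsilon^{\star}=\varepsilon$ for all $\varepsilon\in E$; $O=\{<_{\varepsilon}\mid\varepsilon\in E\}$ is a set of partial orders on $X$; and $\underline{\varepsilon}\colon\coprod_{\lambda\in X}M(\lambda)\to E$, $S\mapsto\varepsilon_S$, is a map such that for all $\lambda\in X$, $S,T\in M(\lambda)$, $\varepsilon\in E$: $\varepsilon R\varepsilon\, C^{\lambda}_{S,T}\subset R(\leq_{\varepsilon}\lambda)$, and $\varepsilon C^{\lambda}_{S,T}=C^{\lambda}_{S,T}$ if $\varepsilon_S=\varepsilon$, $\varepsilon C^{\lambda}_{S,T}=0$ if $\varepsilon_S\neq\varepsilon$. Here $R(\leq_{\varepsilon}\lambda)=\mathbb{K}\{C^{\mu}_{S,T}\mid\mu\in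 X,\mu\leq_{\varepsilon}\lambda,S,T\in M(\mu)\}$, and $R(<_{\varepsilon}\lambda)$ is defined in the same way with $<_{\varepsilon}$. (d) For $\lambda\in X$, $S,T\in M(\lambda)$, $a\in R$: $aC^{\lambda}_{S,T}\in\sum_{S'\in M(\lambda)}r_a(S',S)\,C^{\lambda}_{S',T}+R(<_{\varepsilon_T}\lambda)\varepsilon_T$, with scalars $r_a(S',S)\in\mathbb{K}$ depending only on $a,S,S'$. *)

(* Defs.v *)
From HB Require Import structures.
From Corelib Require Export RelationClasses.
From mathcomp Require Import all_boot all_algebra.
From mathcomp Require Import boolp.
From mathcomp.multinomials Require Import monalg.

Set Implicit Arguments.
Unset Strict Implicit.
Unset Printing Implicit Defensive.

Import GRing.Theory.
Local Open Scope ring_scope.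
Local Open Scope quotient_scope.

Section LinearAlgebra.
Variables (K : fieldType) (V : lmodType K).

Definition span (B : V -> Prop) (x : V) : Prop :=
  exists n (a : 'I_n -> K) (v : 'I_n -> V),
    (forall i, B (v i)) /\ x = \sum_(i < n) a i *: v i.

Definition lin_indep (B : V -> Prop) : Prop :=
  forall n (a : 'I_n -> K) (v : 'I_n -> V),
    injective v -> (forall i, B (v i)) ->
    \sum_(i < n) a i *: v i = 0 -> forall i, a i = 0.

Definition is_basis (B : V -> Prop) : Prop :=
  lin_indep B /\ (forall x, span B x).

End LinearAlgebra.

Section RelativeCellular.
Variables (K : fieldType) (R : algType K).

Definition anti_involution (s : R -> R) : Prop :=
  [/\ linear s, {morph s : x y / x * y >-> y * x} & involutive s].

(* The set of idempotents is the image of the family [cd_idem], which is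
   injective by the axioms [rc_idem_neq0] and [rc_idem_orth] below; the set of
   orders and the map S |-> eps_S are indexed accordingly. *)
Record cell_datum := CellDatum {
  cd_X : Type;
  cd_M : cd_X -> finType;
  cd_C : forall l, cd_M l -> cd_M l -> R;
  cd_star : R -> R;
  cd_I : Type;
  cd_idem : cd_I -> R;
  cd_lt : cd_I -> cd_X -> cd_X -> Prop;
  cd_eps : forall l, cd_M l -> cd_I }.

Variable D : cell_datum.
Local Notation X := (cd_X D).
Local Notation M := (@cd_M D).
Local Notation C := (@cd_C D _).
Local Notation star := (@cd_star D).
Local Notation e := (@cd_idem D).
Local Notation lt := (@cd_lt D).
Local Notation eps := (@cd_eps D _).

Definition cd_C_total (t : {l : X & (M l * M l)%type}) : R :=
  C (tagged t).1 (tagged t).2.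

Definition span_lt (i : cd_I D) (l : X) : R -> Prop :=
  span (fun x => exists m (S T : M m), lt i m l /\ x = C S T).

Definition span_le (i : cd_I D) (l : X) : R -> Prop :=
  span (fun x => exists m (S T : M m), (m = l \/ lt i m l) /\ x = C S T).

Record relative_cellular : Prop := RelativeCellular {
  rc_M_nonempty : forall l, (0 < #|M l|)%N;
  rc_C_inj : injective cd_C_total;
  rc_C_basis : is_basis (fun x => exists t, x = cd_C_total t);
  rc_star : anti_involution star;
  rc_star_C : forall l (S T : M l), star (C S T) = C T S;
  rc_idem_neq0 : forall i, e i != 0;
  rc_idem_idem : forall i, e i * e i = e i;
  rc_idem_orth : forall i j, i <> j -> e i * e j = 0;
  rc_idem_star : forall i, star (e i) = e i;
  rc_order : forall i, StrictOrder (lt i);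
  rc_idem_sub : forall l (S T : M l) i (a : R),
    span_le i l (e i * a * e i * C S T);
  rc_eps : forall l (S T : M l), e (eps S) * C S T = C S T;
  rc_eps_neq : forall l (S T : M l) i, eps S <> i -> e i * C S T = 0;
  rc_mul : exists r : R -> forall l, M l -> M l -> K,
    forall l (S T : M l) (a : R), exists y,
      span_lt (eps T) l y /\
      a * C S T = \sum_(S' : M l) r a l S' S *: C S' T + y * e (eps T) }.

End RelativeCellular.

Section Rmorphism.
Variables (R S : nzRingType) (c : {rmorphism R -> S}).

Lemma rmorph_commB (x y z : R) :
  c (x * y - y * x - z) = c x * c y - c y * c x - c z.
Proof. by rewrite !rmorphB !rmorphM. Qed.

Lemma rmorph_commD (x y z : R) :
  c (x * y - y * x + z) = c x * c y - c y * c x + c z.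
Proof. by rewrite rmorphD rmorphB !rmorphM. Qed.

Lemma rmorph_expB (x : R) n : c (x ^+ n - x) = c x ^+ n - c x.
Proof. by rewrite rmorphB rmorphXn. Qed.

Lemma rmorph_2M (x : R) : c (2%:R * x) = 2%:R * c x.
Proof. by rewrite rmorphM rmorph_nat. Qed.

End Rmorphism.

(* Noncommutative polynomials over [K] in three variables. *)
Notation free3 K := {malg K[{fmonom 'I_3}]}.

Section FreeAlgebra.
Variable K : fieldType.
Local Notation A := (free3 K).

Definition freeE : A := << @fmu 'I_3 (@Ordinal 3 0 isT) >>.
Definition freeF : A := << @fmu 'I_3 (@Ordinal 3 1 isT) >>.
Definition freeH : A := << @fmu 'I_3 (@Ordinal 3 2 isT) >>.

Lemma free3_malgC_comm (c : K) (g : A) : c%:MP * g = g * c%:MP.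
Proof.
rewrite mul_malgC malgZ_def malgM_def fgmulgU; apply: eq_bigr => k _.
by rewrite mulm1 mulrC.
Qed.

Lemma free3_scaleAr (c : K) (g h : A) : c *: (g * h) = g * (c *: h).
Proof. by rewrite -!mul_malgC !mulrA free3_malgC_comm. Qed.

Variable p : nat.

Inductive sl2_relation : A -> Prop :=
| sl2_rel_HE : sl2_relation (freeH * freeE - freeE * freeH - 2%:R * freeE)
| sl2_rel_HF : sl2_relation (freeH * freeF - freeF * freeH + 2%:R * freeF)
| sl2_rel_EF : sl2_relation (freeE * freeF - freeF * freeE - freeH)
| sl2_rel_Ep : sl2_relation (freeE ^+ p)
| sl2_rel_Fp : sl2_relation (freeF ^+ p)
| sl2_rel_Hp : sl2_relation (freeH ^+ p - freeH).

Inductive sl2_ideal : A -> Prop :=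
| sl2_ideal_rel r : sl2_relation r -> sl2_ideal r
| sl2_ideal0 : sl2_ideal 0
| sl2_idealD x y : sl2_ideal x -> sl2_ideal y -> sl2_ideal (x + y)
| sl2_idealMl a x : sl2_ideal x -> sl2_ideal (a * x)
| sl2_idealMr a x : sl2_ideal x -> sl2_ideal (x * a).

Lemma sl2_idealN x : sl2_ideal x -> sl2_ideal (- x).
Proof. by move=> Ix; rewrite -mulN1r; apply: sl2_idealMl. Qed.

Lemma sl2_ideal_coef0 x : (0 < p)%N -> sl2_ideal x -> x@_mone = 0.
Proof.
move=> p0; rewrite -[x@_mone]/((mcoeff mone : {rmorphism A -> K}) x).
set c := (mcoeff mone : {rmorphism A -> K}).
have cgen (i : 'I_3) : c << @fmu 'I_3 i >> = 0.
  rewrite /c /= mcoeffU1 (_ : _ == _ = false) //.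
  by apply/eqP => /(congr1 (@fdeg 'I_3)); rewrite fdegU fdeg1.
have [cE cF cH] : [/\ c freeE = 0, c freeF = 0 & c freeH = 0].
  by split; apply: cgen.
clearbody c.
elim=> {x} [r|||a x _ IH|a x _ IH].
- have p_eq0 : (p == 0%N) = false by rewrite gtn_eqF.
  case; [rewrite rmorph_commB rmorph_2M cE|rewrite rmorph_commD rmorph_2M cF
    |rewrite rmorph_commB cE cF cH|rewrite rmorphXn /= cE|rewrite rmorphXn /= cF
    |rewrite rmorph_expB cH];
    by rewrite ?expr0n ?p_eq0 ?(mulr0, mul0r, subr0, addr0).
- exact: rmorph0.
- by move=> x y _ IHx _ IHy; rewrite rmorphD IHx IHy addr0.
- by rewrite rmorphM IH mulr0.
- by rewrite rmorphM IH mul0r.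
Qed.

Definition sl2_equiv (x y : A) : bool := `[< sl2_ideal (x - y) >].

Lemma sl2_equiv_is_equiv : equiv_class_of sl2_equiv.
Proof.
split=> [x|x y|y x z].
- by apply/asboolP; rewrite subrr; apply: sl2_ideal0.
- by apply/asboolP/asboolP => /sl2_idealN; rewrite opprB.
- move=> /asboolP xy /asboolP yz; apply/asboolP.
  by rewrite -(subrKA y); apply: sl2_idealD.
Qed.

Canonical sl2_equiv_equiv := EquivRelPack sl2_equiv_is_equiv.
Canonical sl2_equiv_encModRel := defaultEncModRel sl2_equiv.

End FreeAlgebra.

Section RestrictedEnveloping.
Variables (K : fieldType) (p : nat).

(* The characteristic is an argument because mathcomp algebras are nontrivial
   rings, and for [p = 0] the relations would give [1 = 0]. *)
Definition usl2 (charKp : p \in [pchar K]) : Type :=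
  {eq_quot (@sl2_equiv K p)}.

Variable charKp : p \in [pchar K].
Local Notation u := (usl2 charKp).
Local Notation A := (free3 K).

HB.instance Definition _ := Choice.on u.
HB.instance Definition _ := EqQuotient.on u.

Lemma usl2P (x y : A) : \pi_u x = \pi_u y <-> sl2_ideal p (x - y).
Proof.
by split=> [/eqmodP /asboolP//|h]; apply/eqmodP/asboolP.
Qed.

Lemma usl2_repr (x : A) : sl2_ideal p (repr (\pi_u x) - x).
Proof. by apply/usl2P; rewrite reprK. Qed.

Definition usl2_zero : u := \pi_u 0.
Definition usl2_one : u := \pi_u 1.
Definition usl2_opp (x : u) : u := \pi_u (- repr x).
Definition usl2_add (x y : u) : u := \pi_u (repr x + repr y).
Definition usl2_mul (x y : u) : u := \pi_u (repr x * repr y).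
Definition usl2_scale (c : K) (x : u) : u := \pi_u (c *: repr x).

Lemma usl2_pi_opp x : usl2_opp (\pi_u x) = \pi_u (- x).
Proof.
by apply/usl2P; rewrite -opprD; apply: sl2_idealN; apply: usl2_repr.
Qed.

Lemma usl2_pi_add x y : usl2_add (\pi_u x) (\pi_u y) = \pi_u (x + y).
Proof.
apply/usl2P; rewrite opprD addrACA.
by apply: sl2_idealD; apply: usl2_repr.
Qed.

Lemma usl2_pi_mul x y : usl2_mul (\pi_u x) (\pi_u y) = \pi_u (x * y).
Proof.
apply/usl2P; set x' := repr _; set y' := repr _.
have -> : x' * y' - x * y = x' * (y' - y) + (x' - x) * y.
  by rewrite mulrBr mulrBl subrKA.
by apply: sl2_idealD; [apply: sl2_idealMl|apply: sl2_idealMr]; apply: usl2_repr.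
Qed.

Lemma usl2_pi_scale c x : usl2_scale c (\pi_u x) = \pi_u (c *: x).
Proof.
apply/usl2P; rewrite -scalerBr -mul_malgC.
by apply: sl2_idealMl; apply: usl2_repr.
Qed.

Lemma usl2_ind (P : u -> Prop) : (forall x : A, P (\pi_u x)) -> forall x, P x.
Proof. by move=> h x; rewrite -[x]reprK. Qed.

Let piE := (usl2_pi_opp, usl2_pi_add, usl2_pi_mul, usl2_pi_scale).

Lemma usl2_addA : associative usl2_add.
Proof. by do 3!elim/usl2_ind=> ?; rewrite !piE addrA. Qed.

Lemma usl2_addC : commutative usl2_add.
Proof. by do 2!elim/usl2_ind=> ?; rewrite !piE addrC. Qed.

Lemma usl2_add0 : left_id usl2_zero usl2_add.
Proof. by elim/usl2_ind=> ?; rewrite /usl2_zero !piE add0r. Qed.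

Lemma usl2_addN : left_inverse usl2_zero usl2_opp usl2_add.
Proof. by elim/usl2_ind=> ?; rewrite !piE addNr. Qed.

HB.instance Definition _ :=
  GRing.isZmodule.Build u usl2_addA usl2_addC usl2_add0 usl2_addN.

Lemma usl2_mulA : associative usl2_mul.
Proof. by do 3!elim/usl2_ind=> ?; rewrite !piE mulrA. Qed.

Lemma usl2_mul1l : left_id usl2_one usl2_mul.
Proof. by elim/usl2_ind=> ?; rewrite /usl2_one !piE mul1r. Qed.

Lemma usl2_mul1r : right_id usl2_one usl2_mul.
Proof. by elim/usl2_ind=> ?; rewrite /usl2_one !piE mulr1. Qed.

Lemma usl2_mulDl : left_distributive usl2_mul +%R.
Proof.
by do 3!elim/usl2_ind=> ?; rewrite -![_ + _]/(usl2_add _ _) !piE mulrDl.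
Qed.

Lemma usl2_mulDr : right_distributive usl2_mul +%R.
Proof.
by do 3!elim/usl2_ind=> ?; rewrite -![_ + _]/(usl2_add _ _) !piE mulrDr.
Qed.

Lemma usl2_one_neq0 : usl2_one != 0.
Proof.
apply/eqP => /usl2P /(sl2_ideal_coef0 (prime_gt0 (pcharf_prime charKp))).
by rewrite subr0 mcoeff1 eqxx => /eqP; rewrite oner_eq0.
Qed.

HB.instance Definition _ := GRing.Zmodule_isNzRing.Build u
  usl2_mulA usl2_mul1l usl2_mul1r usl2_mulDl usl2_mulDr usl2_one_neq0.

Lemma usl2_scaleA a b x : usl2_scale a (usl2_scale b x) = usl2_scale (a * b) x.
Proof. by elim/usl2_ind: x => ?; rewrite !piE scalerA. Qed.

Lemma usl2_scale1 : left_id 1 usl2_scale.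
Proof. by elim/usl2_ind=> ?; rewrite !piE scale1r. Qed.

Lemma usl2_scaleDr : right_distributive usl2_scale +%R.
Proof.
move=> c; do 2!elim/usl2_ind=> ?.
by rewrite -![_ + _]/(usl2_add _ _) !piE scalerDr.
Qed.

Lemma usl2_scaleDl x : {morph usl2_scale^~ x : a b / a + b}.
Proof.
elim/usl2_ind: x => x a b.
by rewrite -[RHS]/(usl2_add _ _) !piE scalerDl.
Qed.

HB.instance Definition _ := GRing.Zmodule_isLmodule.Build K u
  usl2_scaleA usl2_scale1 usl2_scaleDr usl2_scaleDl.

Lemma usl2_scaleAl (c : K) (x y : u) : c *: (x * y) = (c *: x) * y.
Proof.
elim/usl2_ind: x => x; elim/usl2_ind: y => y.
rewrite -[LHS]/(usl2_scale _ (usl2_mul _ _)).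
by rewrite -[RHS]/(usl2_mul (usl2_scale _ _) _) !piE scalerAl.
Qed.

HB.instance Definition _ := GRing.Lmodule_isLalgebra.Build K u usl2_scaleAl.

Lemma usl2_scaleAr (c : K) (x y : u) : c *: (x * y) = x * (c *: y).
Proof.
elim/usl2_ind: x => x; elim/usl2_ind: y => y.
rewrite -[LHS]/(usl2_scale _ (usl2_mul _ _)).
by rewrite -[RHS]/(usl2_mul _ (usl2_scale _ _)) !piE free3_scaleAr.
Qed.

HB.instance Definition _ := GRing.Lalgebra_isAlgebra.Build K u usl2_scaleAr.

Definition usl2_pi (x : A) : u := \pi_u x.

Lemma usl2_pi_is_zmod_morphism : zmod_morphism usl2_pi.
Proof. by move=> x y; rewrite /usl2_pi -usl2_pi_add -usl2_pi_opp. Qed.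

HB.instance Definition _ :=
  GRing.isZmodMorphism.Build A u usl2_pi usl2_pi_is_zmod_morphism.

Lemma usl2_pi_is_monoid_morphism : monoid_morphism usl2_pi.
Proof. by split=> [//|x y]; rewrite /usl2_pi -usl2_pi_mul. Qed.

HB.instance Definition _ :=
  GRing.isMonoidMorphism.Build A u usl2_pi usl2_pi_is_monoid_morphism.

Lemma usl2_pi_is_scalable : scalable usl2_pi.
Proof. by move=> c x; rewrite /usl2_pi -usl2_pi_scale. Qed.

HB.instance Definition _ :=
  GRing.isScalable.Build K A u *:%R usl2_pi usl2_pi_is_scalable.

Definition uE : u := usl2_pi (freeE K).
Definition uF : u := usl2_pi (freeF K).
Definition uH : u := usl2_pi (freeH K).

Lemma usl2_pi_ideal x : sl2_ideal p x -> usl2_pi x = 0.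
Proof. by move=> Ix; apply/usl2P; rewrite subr0. Qed.

Lemma uHE : uH * uE - uE * uH = 2%:R * uE.
Proof.
apply/subr0_eq; rewrite -rmorph_2M -rmorph_commB.
exact/usl2_pi_ideal/sl2_ideal_rel/sl2_rel_HE.
Qed.

Lemma uHF : uH * uF - uF * uH = - (2%:R * uF).
Proof.
apply/eqP; rewrite -addr_eq0 -rmorph_2M -rmorph_commD; apply/eqP.
exact/usl2_pi_ideal/sl2_ideal_rel/sl2_rel_HF.
Qed.

Lemma uEF : uE * uF - uF * uE = uH.
Proof.
apply/subr0_eq; rewrite -rmorph_commB.
exact/usl2_pi_ideal/sl2_ideal_rel/sl2_rel_EF.
Qed.

Lemma uEp : uE ^+ p = 0.
Proof. by rewrite -rmorphXn; apply/usl2_pi_ideal/sl2_ideal_rel/sl2_rel_Ep. Qed.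

Lemma uFp : uF ^+ p = 0.
Proof. by rewrite -rmorphXn; apply/usl2_pi_ideal/sl2_ideal_rel/sl2_rel_Fp. Qed.

Lemma uHp : uH ^+ p - uH = 0.
Proof.
by rewrite -rmorph_expB; apply/usl2_pi_ideal/sl2_ideal_rel/sl2_rel_Hp.
Qed.

(* [(mu : nat)%:R : u] is the image of [mu] under F_p -> K -> u. *)
Definition u_idem (l : 'F_p) : u :=
  - \prod_(mu : 'F_p | mu != l) (uH - (mu : nat)%:R).

Definition sl2_M (l : 'F_p) : finType := 'I_p.

Definition sl2_C (l : 'F_p) (S T : sl2_M l) : u :=
  uF ^+ (S : 'I_p) * u_idem l * uE ^+ (T : 'I_p).

(* The order l + 2(p-1) < ... < l + 4 < l + 2 < l. *)
Definition sl2_lt (l mu nu : 'F_p) : Prop :=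
  exists i j : nat,
    [/\ (j < i < p)%N, mu = l + (2 * i)%:R & nu = l + (2 * j)%:R].

Definition sl2_eps (l : 'F_p) (S : sl2_M l) : 'F_p :=
  l - (2 * (S : 'I_p))%:R.

Definition sl2_datum (star : u -> u) : cell_datum u :=
  {| cd_X := 'F_p;
     cd_M := sl2_M;
     cd_C := sl2_C;
     cd_star := star;
     cd_I := 'F_p;
     cd_idem := u_idem;
     cd_lt := sl2_lt;
     cd_eps := sl2_eps |}.

End RestrictedEnveloping.

Definition strict_total_order (T : Type) (lt : T -> T -> Prop) : Prop :=
  StrictOrder lt /\ (forall x y, [\/ lt x y, x = y | lt y x]).

(* Main.v *)
(* Lagrange interpolation at the points of F_p shows that the 1_l are orthogonal
   idempotents with sum 1 and H 1_l = l 1_l, so that multiplication by E or F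
   shifts weights by 2 and the monomials F^S 1_l E^T span a left ideal
   containing 1.  They are independent because the algebra acts on the right on the space
   K^(p^3) they should span: the vector sum_l (0,l,0) is sent by F^S 1_l E^T to
   the basis vector (S,l,T).  The coordinates so obtained define star, and star
   is an anti-morphism because the formulas for E (F^S 1_l E^T) and
   (F^T 1_l E^S) F are mirror images of each other.
   For the multiplication axiom, expand a F^S 1_l = a F^S 1_l 1_l: only terms
   F^S' 1_(l+2T') E^T' occur, and multiplying them by E^T on the right gives the
   terms with T' = 0, whose coefficients do not depend on T, plus strictly
   smaller ones.  For the axiom on the corner algebra, 1_i a 1_i is a
   combination of F^n 1_(i+2n) E^n, and E^n F^S 1_l E^T is a combination of
   F^b 1_(l+2d) E^(T+d) with b + n = S + d, so that F^n raises the exponent of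
   F back to S + d >= S. *)

From HB Require Import structures.
Require Import Defs.
From mathcomp Require Import all_boot all_algebra.
From mathcomp Require Import boolp ring.
From mathcomp.multinomials Require Import monalg.

Set Implicit Arguments.
Unset Strict Implicit.
Unset Printing Implicit Defensive.

(* [Defs] again: [span] must not be the one of mathcomp's [vector]. *)
Import Defs GRing.Theory.
Local Open Scope ring_scope.
Local Open Scope quotient_scope.

(** * Commutation in an sl2-triple *)

Section Sl2Triple.
Variables (R : nzRingType) (e f h : R).
Hypotheses (he : h * e - e * h = 2%:R * e) (hf : h * f - f * h = - (2%:R * f)).
Hypothesis ef : e * f - f * e = h.

Lemma sl2_mulhfB (x : R) n : x * f ^+ n = f ^+ n * (x - (2 * n)%:R) ->
  forall m, (x - m%:R) * f ^+ n = f ^+ n * (x - (2 * n + m)%:R).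
Proof.
move=> xE m; rewrite mulrBl xE mulr_natl -[_ *+ m]mulr_natr -mulrBr.
by rewrite -addrA -opprD -natrD.
Qed.

Lemma sl2_mulhf n : h * f ^+ n = f ^+ n * (h - (2 * n)%:R).
Proof.
elim: n => [|n IH]; first by rewrite muln0 subr0 mul1r mulr1.
have hf2 : h * f = f * (h - 2%:R).
  by rewrite mulrBr mulr_natr -[f *+ 2]mulr_natl -hf addrCA subrr addr0.
by rewrite exprS mulrA hf2 -mulrA sl2_mulhfB // mulrA mulnSr.
Qed.

Lemma sl2_muleh n : e ^+ n * h = (h - (2 * n)%:R) * e ^+ n.
Proof.
elim: n => [|n IH]; first by rewrite muln0 subr0 mul1r mulr1.
have eh2 : e * h = (h - 2%:R) * e by rewrite mulrBl -he subKr.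
rewrite exprSr -mulrA eh2 mulrA mulrBr IH mulr_natr -[_ *+ 2]mulr_natl -mulrBl.
by rewrite -addrA -opprD -natrD mulnSr -mulrA.
Qed.

Lemma sl2_mulfh n : f ^+ n * h = (h + (2 * n)%:R) * f ^+ n.
Proof. by rewrite mulrDl sl2_mulhf mulrBr mulr_natr mulr_natl subrK. Qed.

Lemma sl2_mulhe n : h * e ^+ n = e ^+ n * (h + (2 * n)%:R).
Proof. by rewrite mulrDr sl2_muleh mulrBl mulr_natr mulr_natl subrK. Qed.

(** Both sides equal [(n+2)x - (n+1)(n+2)]. This is the arithmetic of the inductive step in the two
    commutation formulas that follow. *)
Lemma natr_shift (x : R) n :
  x + (x - n.+2%:R) *+ n.+1 = (x - n.+1%:R) *+ n.+2.
Proof.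
rewrite !mulrnBl addrA -mulrS; congr (_ - _).
by rewrite -!mulrnA mulnC.
Qed.

(** Moving [e] through the factors [f] leaves the terms [h, h - 2, ..., h - 2n] once the powers of
    [f] are collected on the left; they add up to [(n+1)(h - n)]. *)
Lemma sl2_mulef n :
  e * f ^+ n.+1 = f ^+ n.+1 * e + (f ^+ n * (h - n%:R)) *+ n.+1.
Proof.
have efE : e * f = f * e + h by rewrite -ef addrC subrK.
elim: n => [|n IH]; first by rewrite !expr1 expr0 mul1r subr0.
have hnf : (h - n%:R) * f = f * (h - n.+2%:R).
  by have := sl2_mulhfB (sl2_mulhf 1) n; rewrite expr1 muln1 add2n.
rewrite exprSr mulrA IH mulrDl mulrnAl -!mulrA hnf efE mulrDr !mulrA -!exprSr.
by rewrite -addrA -mulrnAr -mulrDr natr_shift mulrnAr.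
Qed.

(** Mirror image of [sl2_mulef]; having both forms is what later makes the star map reverse
    products. *)
Lemma sl2_mulef_r n :
  e ^+ n.+1 * f = f * e ^+ n.+1 + ((h - n%:R) * e ^+ n) *+ n.+1.
Proof.
have efE : e * f = f * e + h by rewrite -ef addrC subrK.
elim: n => [|n IH]; first by rewrite !expr1 expr0 mulr1 subr0.
have ehn : e * (h - n%:R) = (h - n.+2%:R) * e.
  have := sl2_muleh 1; rewrite expr1 muln1 => eh2.
  rewrite mulrBr eh2 mulr_natr -[_ *+ n]mulr_natl -mulrBl.
  by rewrite -addrA -opprD -natrD add2n.
rewrite exprS -mulrA IH mulrDr mulrnAr !mulrA ehn efE mulrDl -!mulrA -!exprS.
by rewrite -addrA -mulrnAl -mulrDl natr_shift mulrnAl.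
Qed.

End Sl2Triple.

Section ShiftedEigenvectors.
Variables (K : fieldType) (R : algType K) (h x : R) (a : K) (n : nat).

Lemma eigenlDn : h * x = a *: x -> (h + n%:R) * x = (a + n%:R) *: x.
Proof. by rewrite mulrDl scalerDl mulr_natl scaler_nat => ->. Qed.

Lemma eigenlBn : h * x = a *: x -> (h - n%:R) * x = (a - n%:R) *: x.
Proof. by rewrite mulrBl scalerBl mulr_natl scaler_nat => ->. Qed.

Lemma eigenrDn : x * h = a *: x -> x * (h + n%:R) = (a + n%:R) *: x.
Proof. by rewrite mulrDr scalerDl mulr_natr scaler_nat => ->. Qed.

Lemma eigenrBn : x * h = a *: x -> x * (h - n%:R) = (a - n%:R) *: x.
Proof. by rewrite mulrBr scalerBl mulr_natr scaler_nat => ->. Qed.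

End ShiftedEigenvectors.

(** * Prime field and interpolation polynomials *)

Section PrimeFieldEmbedding.
Variables (K : fieldType) (p : nat) (charKp : p \in [pchar K]).

(** The characteristic is an argument so that the ring morphism structure, which depends on it, can
    be attached to this constant. *)
Definition Fp_emb of p \in [pchar K] := fun a : 'F_p => (a : nat)%:R : K.
Local Notation k := (Fp_emb charKp).

Lemma Fp_emb_nat n : k n%:R = n%:R.
Proof.
by rewrite /Fp_emb val_Fp_nat ?(pcharf_prime charKp) // GRing.natr_mod_pchar.
Qed.

Lemma Fp_emb_zmod_morphism : zmod_morphism k.
Proof.
suff kD a b : k (a + b) = k a + k b.
  by move=> a b; apply/eqP; rewrite eq_sym subr_eq -kD subrK.
by rewrite -[a]natr_Zp -[b]natr_Zp -natrD !Fp_emb_nat natrD.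
Qed.

Lemma Fp_emb_monoid_morphism : monoid_morphism k.
Proof.
split=> [|a b]; first by rewrite -[1]/(1%:R) Fp_emb_nat.
by rewrite -[a]natr_Zp -[b]natr_Zp -natrM !Fp_emb_nat natrM.
Qed.

HB.instance Definition _ :=
  GRing.isZmodMorphism.Build 'F_p K k Fp_emb_zmod_morphism.
HB.instance Definition _ :=
  GRing.isMonoidMorphism.Build 'F_p K k Fp_emb_monoid_morphism.

Lemma Fp_emb_subn a n : k (a - n%:R) = k a - n%:R.
Proof. by rewrite rmorphB /= Fp_emb_nat. Qed.

Lemma Fp_emb_addn a n : k (a + n%:R) = k a + n%:R.
Proof. by rewrite rmorphD /= Fp_emb_nat. Qed.

Lemma Fp_emb_exp a : k a ^+ p = k a.
Proof. by rewrite -pFrobenius_autE pFrobenius_aut_nat. Qed.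

Lemma size_XpBX : size ('X^p - 'X : {poly K}) = p.+1.
Proof.
have p_gt1 := prime_gt1 (pcharf_prime charKp).
by rewrite size_polyDl size_polyXn // size_polyN size_polyX ltnS.
Qed.

(** The left side is monic of degree p and has the p distinct elements of the prime field as
    roots. *)
Lemma XpBX_prod : 'X^p - 'X = \prod_(a : 'F_p) ('X - (k a)%:P).
Proof.
have p_gt1 := prime_gt1 (pcharf_prime charKp).
pose rs := [seq k a | a <- index_enum 'F_p].
have -> : \prod_(a : 'F_p) ('X - (k a)%:P) = \prod_(z <- rs) ('X - z%:P).
  by rewrite big_map.
rewrite [LHS](@all_roots_prod_XsubC _ _ rs).
- rewrite lead_coefDl ?lead_coefXn ?scale1r //.
  by rewrite size_polyN size_polyX size_polyXn ltnS.
- by rewrite size_XpBX size_map -[in LHS](card_Fp (pcharf_prime charKp)) cardT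
    enumT [index_enum _]unlock.
- apply/allP => _ /mapP[a _ ->].
  by rewrite rootE !hornerE Fp_emb_exp subrr.
- rewrite uniq_rootsE map_inj_uniq ?index_enum_uniq //; exact: fmorph_inj.
Qed.

(** The Lagrange polynomial of the node [l]: its denominator, the product of all non-zero elements
    of the prime field, is -1 by Wilson's theorem. *)
Definition Fp_idem_poly (l : 'F_p) : {poly K} :=
  - \prod_(a : 'F_p | a != l) ('X - (k a)%:P).

Lemma Fp_idem_polyM l : ('X - (k l)%:P) * Fp_idem_poly l = - ('X^p - 'X).
Proof. by rewrite mulrN XpBX_prod [in RHS](bigD1 l). Qed.

Lemma Fp_idem_poly_horner l a : (Fp_idem_poly l).[k a] = (a == l)%:R.
Proof.
have [->|al] := eqVneq a l; last first.
  by rewrite hornerN horner_prod (bigD1 a) //= !hornerE subrr mul0r oppr0.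
(* The derivative at the node of [(X - l) P = X - X^p] gives the value of [P] on the left and 1 on
   the right, because p is 0 in [K]. *)
have /(congr1 (fun q : {poly K} => q^`().[k l])) := Fp_idem_polyM l.
rewrite derivM !derivE !hornerE /= subrr mul0r addr0.
by rewrite -hornerN => ->; rewrite hornerMn mulrn_pchar // sub0r opprK.
Qed.

Lemma sum_Fp_idem_poly : \sum_l Fp_idem_poly l = 1.
Proof.
have p_prime := pcharf_prime charKp.
apply/eqP; rewrite -subr_eq0; apply/eqP.
apply: (@roots_geq_poly_eq0 _ _ [seq k a | a <- enum 'F_p]).
- apply/allP => _ /mapP[a _ ->].
  rewrite rootE !hornerE horner_sum (bigD1 a) //= Fp_idem_poly_horner eqxx.
  rewrite big1 ?addr0 ?subrr // => l la.
  by rewrite Fp_idem_poly_horner eq_sym (negPf la).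
- rewrite map_inj_uniq ?enum_uniq //; exact: fmorph_inj.
rewrite size_map -cardT card_Fp //.
apply: leq_trans (size_polyD _ _) _; rewrite geq_max size_polyN size_poly1.
rewrite prime_gt0 // andbT; apply: leq_trans (size_sum _ _ _) _.
(* Each product has fewer than p linear factors, since [l] itself is left out. *)
apply/bigmax_leqP => l _; rewrite size_polyN -big_filter size_prod_XsubC.
rewrite -[X in (_ < X)%N](card_Fp p_prime) cardT enumT size_filter.
rewrite ltn_neqAle count_size andbT -all_count.
by apply/allPn; exists l; rewrite ?mem_index_enum ?eqxx.
Qed.

End PrimeFieldEmbedding.

(** * Linear spans and the orders on F_p *)

Section Span.
Variables (K : fieldType) (V : lmodType K) (B : V -> Prop).

Lemma span_in x : B x -> span B x.
Proof.
move=> Bx; exists 1%N, (fun=> 1), (fun=> x); split=> //.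
by rewrite big_ord1 scale1r.
Qed.

Lemma span0 : span B 0.
Proof. by exists 0%N, (fun=> 0), (fun=> 0); split=> [[]|]; rewrite ?big_ord0. Qed.

Lemma spanD x y : span B x -> span B y -> span B (x + y).
Proof.
move=> [n [a [v [Bv ->]]]] [m [b [w [Bw ->]]]].
exists (n + m)%N, (fun i => match split i with inl j => a j | inr j => b j end),
  (fun i => match split i with inl j => v j | inr j => w j end).
split=> [i|]; first by case: split.
by rewrite big_split_ord /=; congr (_ + _); apply: eq_bigr => i _;
  rewrite ?(unsplitK (inl i)) ?(unsplitK (inr i)).
Qed.

Lemma spanZ c x : span B x -> span B (c *: x).
Proof.
move=> [n [a [v [Bv ->]]]]; exists n, (fun i => c * a i), v; split=> //.
by rewrite scaler_sumr; apply: eq_bigr => i _; rewrite scalerA.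
Qed.

Lemma span_sum (I : Type) (r : seq I) (P : pred I) (f : I -> V) :
  (forall i, P i -> span B (f i)) -> span B (\sum_(i <- r | P i) f i).
Proof. by move=> Bf; elim/big_ind: _ => //; [exact: span0|exact: spanD]. Qed.

End Span.

Lemma span_map (K : fieldType) (V W : lmodType K) (B : V -> Prop)
    (B' : W -> Prop) (g : V -> W) x :
  linear g -> (forall y, B y -> span B' (g y)) -> span B x -> span B' (g x).
Proof.
move=> g_lin Bg [n [a [v [Bv ->]]]].
pose gl := GRing.isLinear.Build _ _ _ _ g g_lin.
pose gL : {linear V -> W} := HB.pack g gl.
rewrite -[g _]/(gL _) linear_sum; apply: span_sum => i _.
by rewrite linearZ; apply/spanZ/Bg.
Qed.

Section Sl2Order.
Variables (p : nat) (p_prime : prime p) (p_gt2 : (2 < p)%N).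

Lemma Fp2_neq0 : 2%:R != 0 :> 'F_p.
Proof.
by apply/eqP => /(congr1 (@nat_of_ord _)); rewrite val_Fp_nat // modn_small.
Qed.

Lemma Fp_natr_inj i j : (i < p)%N -> (j < p)%N -> i%:R = j%:R :> 'F_p -> i = j.
Proof.
move=> ip jp /(congr1 (@nat_of_ord _)).
by rewrite !val_Fp_nat // !modn_small.
Qed.

Lemma Fp_double_inj (l : 'F_p) i j : (i < p)%N -> (j < p)%N ->
  l + (2 * i)%:R = l + (2 * j)%:R -> i = j.
Proof.
move=> ip jp /addrI; rewrite !natrM => /(mulfI Fp2_neq0); exact: Fp_natr_inj.
Qed.

(** As p is odd, 2 is invertible. With [Fp_double_inj], every element has a unique position i < p in
    the list [l, l + 2, l + 4, ...], and [sl2_lt l] is the reverse order of positions. *)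
Lemma Fp_double_surj (l m : 'F_p) : exists2 i, (i < p)%N & m = l + (2 * i)%:R.
Proof.
exists ((m - l) / 2%:R : 'F_p); first by rewrite -[X in (_ < X)%N](Fp_cast p_prime).
by rewrite natrM natr_Zp mulrC divfK ?Fp2_neq0 // addrC subrK.
Qed.

Lemma sl2_lt_total (l : 'F_p) : strict_total_order (sl2_lt l).
Proof.
split; last first.
  move=> x y; have [i ip ->] := Fp_double_surj l x.
  have [j jp ->] := Fp_double_surj l y.
  have [ij|ij|->] := ltngtP i j; last exact: Or32.
    by apply: Or33; exists j, i; rewrite ij.
  by apply: Or31; exists i, j; rewrite ij.
split=> [x|x y z].
  case=> i [j [/andP[ji ip] -> /Fp_double_inj]] ij.
  have jp := ltn_trans ji ip.
  by move: ji; rewrite (ij ip jp) ltnn.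
(* The middle element comes with two positions, [j] and [j'], which agree by injectivity of
   doubling. *)
case=> i [j [/andP[ji ip] -> ->]] [j' [n [/andP[nj jp] jj' ->]]].
exists i, n; split=> //; rewrite ip andbT; apply: ltn_trans nj _.
by rewrite -(Fp_double_inj (ltn_trans ji ip) jp jj').
Qed.

(** The bound on [a + m] prevents the list of positions from wrapping around past its least
    element. *)
Lemma sl2_lt_shift (i l : 'F_p) a m : l = i + (2 * a)%:R -> (0 < m)%N ->
  (a + m < p)%N -> sl2_lt i (l + (2 * m)%:R) l.
Proof.
move=> -> m0 amp; exists (a + m)%N, a; split=> //.
  by rewrite amp andbT -[X in (X < _)%N]addn0 ltn_add2l.
by rewrite -addrA -natrD mulnDr.
Qed.

End Sl2Order.

(** * Restricted sl2-triples *)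

Section RestrictedTriple.
Variables (K : fieldType) (p : nat) (charKp : p \in [pchar K]).
Variables (R : algType K) (E F H : R).
Hypotheses (HE : H * E - E * H = 2%:R * E) (HF : H * F - F * H = - (2%:R * F)).
Hypotheses (EF : E * F - F * E = H) (Ep : E ^+ p = 0) (Fp : F ^+ p = 0).
Hypothesis Hp : H ^+ p - H = 0.
Local Notation k := (Fp_emb charKp).

(** Stated for any triple, as it serves both in the restricted enveloping algebra, where it is
    [u_idem] by conversion, and among the operators on the regular module. *)
Definition weight_idem (l : 'F_p) : R :=
  - \prod_(mu : 'F_p | mu != l) (H - (mu : nat)%:R).
Local Notation idem := weight_idem.

Lemma weight_idem_horner l : idem l = horner_alg H (Fp_idem_poly charKp l).
Proof.
rewrite rmorphN rmorph_prod; congr (- _); apply: eq_bigr => a _.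
by rewrite rmorphB /= horner_algX horner_algC scaler_nat.
Qed.

Lemma sum_weight_idem : \sum_l idem l = 1.
Proof.
under eq_bigr do rewrite weight_idem_horner.
by rewrite -rmorph_sum sum_Fp_idem_poly rmorph1.
Qed.

Lemma mulH_weight_idem l : H * idem l = k l *: idem l.
Proof.
apply/eqP; rewrite -subr_eq0 -mulr_algl -mulrBl weight_idem_horner.
rewrite -[X in X - _](horner_algX H) -(horner_algC H) -rmorphB -rmorphM.
by rewrite Fp_idem_polyM rmorphN rmorphB rmorphXn /= horner_algX Hp oppr0.
Qed.

Lemma weight_idem_mulH l : idem l * H = k l *: idem l.
Proof.
rewrite -mulH_weight_idem weight_idem_horner.
have := congr1 (horner_alg H) (mulrC (Fp_idem_poly charKp l) 'X).
by rewrite !rmorphM /= horner_algX.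
Qed.

(** Evaluating [idem l * H * x] in two ways gives the scalars [k l] and [k m], so [idem l] kills [x]
    unless [l = m]; since the idempotents sum to 1, the remaining one fixes [x]. *)
Lemma weight_idem_mull m x : H * x = k m *: x ->
  forall l, idem l * x = x *+ (l == m).
Proof.
move=> Hx; have idem0 l : l != m -> idem l * x = 0.
  move=> lm; have /eqP : (k l - k m) *: (idem l * x) = 0.
    by rewrite scalerBl [k l *: _]scalerAl -weight_idem_mulH -mulrA Hx
      -scalerAr subrr.
  by rewrite scaler_eq0 -rmorphB fmorph_eq0 subr_eq0 (negPf lm) => /eqP.
move=> l; have [->|/idem0//] := eqVneq l m.
have xE : x = \sum_i idem i * x by rewrite -mulr_suml sum_weight_idem mul1r.
by rewrite [RHS]xE (bigD1 m) //= big1 ?addr0 // => i /idem0.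
Qed.

Lemma weight_idem_mulr m x : x * H = k m *: x ->
  forall l, x * idem l = x *+ (l == m).
Proof.
move=> xH; have idem0 l : l != m -> x * idem l = 0.
  move=> lm; have /eqP : (k l - k m) *: (x * idem l) = 0.
    by rewrite scalerBl [k l *: _]scalerAr -mulH_weight_idem mulrA xH
      -scalerAl subrr.
  by rewrite scaler_eq0 -rmorphB fmorph_eq0 subr_eq0 (negPf lm) => /eqP.
move=> l; have [->|/idem0//] := eqVneq l m.
have xE : x = \sum_i x * idem i by rewrite -mulr_sumr sum_weight_idem mulr1.
by rewrite [RHS]xE (bigD1 m) //= big1 ?addr0 // => i /idem0.
Qed.

Lemma weight_idemM l m : idem l * idem m = idem m *+ (l == m).
Proof. exact/weight_idem_mull/mulH_weight_idem. Qed.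

(** Both sides equal [idem (l - 2n) * F^n * idem l]: the left one is a left weight vector, the right
    one a right weight vector. *)
Lemma mulFX_weight_idem l n : F ^+ n * idem l = idem (l - (2 * n)%:R) * F ^+ n.
Proof.
have wl : H * (F ^+ n * idem l) = k (l - (2 * n)%:R) *: (F ^+ n * idem l).
  by rewrite mulrA (sl2_mulhf HF) -mulrA (eigenlBn _ (mulH_weight_idem l)) -scalerAr
    Fp_emb_subn.
have wr : idem (l - (2 * n)%:R) * F ^+ n * H
          = k l *: (idem (l - (2 * n)%:R) * F ^+ n).
  by rewrite -mulrA (sl2_mulfh HF) mulrA (eigenrDn _ (weight_idem_mulH _)) -scalerAl
    -Fp_emb_addn subrK.
have := weight_idem_mull wl (l - (2 * n)%:R); rewrite eqxx mulr1n => <-.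
by have := weight_idem_mulr wr l; rewrite eqxx mulr1n mulrA.
Qed.

Lemma mulEX_weight_idem l n : E ^+ n * idem l = idem (l + (2 * n)%:R) * E ^+ n.
Proof.
have wl : H * (E ^+ n * idem l) = k (l + (2 * n)%:R) *: (E ^+ n * idem l).
  by rewrite mulrA (sl2_mulhe HE) -mulrA (eigenlDn _ (mulH_weight_idem l)) -scalerAr
    Fp_emb_addn.
have wr : idem (l + (2 * n)%:R) * E ^+ n * H
          = k l *: (idem (l + (2 * n)%:R) * E ^+ n).
  by rewrite -mulrA (sl2_muleh HE) mulrA (eigenrBn _ (weight_idem_mulH _)) -scalerAl
    -Fp_emb_subn addrK.
have := weight_idem_mull wl (l + (2 * n)%:R); rewrite eqxx mulr1n => <-.
by have := weight_idem_mulr wr l; rewrite eqxx mulr1n mulrA.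
Qed.

(** * Cell monomials and their products with the generators *)

Definition cell (S : nat) (l : 'F_p) (T : nat) : R := F ^+ S * idem l * E ^+ T.
Local Notation C := cell.

Definition cell_coef (S : nat) (l : 'F_p) : K := (k l - S%:R) *+ S.+1.

(** This allows [cell] to take arbitrary natural exponents, so that the product formulas hold
    without range conditions. *)
Lemma cell_eq0 S l T : ~~ ((S < p) && (T < p))%N -> C S l T = 0.
Proof.
rewrite negb_and -!leqNgt /C => /orP[] /subnKC <-; rewrite exprD.
  by rewrite Fp !mul0r.
by rewrite Ep mul0r mulr0.
Qed.

Lemma cell00 l : C 0 l 0 = idem l.
Proof. by rewrite /C !expr0 mul1r mulr1. Qed.

Lemma sum_cell00 : \sum_l C 0 l 0 = 1.
Proof. by under eq_bigr do rewrite cell00; exact: sum_weight_idem. Qed.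

Lemma cell_addr S l T n : C S l (T + n) = C S l T * E ^+ n.
Proof. by rewrite /C exprD !mulrA. Qed.

Lemma cell_addl n S l T : C (n + S) l T = F ^+ n * C S l T.
Proof. by rewrite /C exprD !mulrA. Qed.

Lemma mulF_cell S l T : F * C S l T = C S.+1 l T.
Proof. by rewrite -add1n cell_addl expr1. Qed.

Lemma cell_mulE S l T : C S l T * E = C S l T.+1.
Proof. by rewrite -addn1 cell_addr expr1. Qed.

Lemma mulH_cell S l T : H * C S l T = k (l - (2 * S)%:R) *: C S l T.
Proof. by rewrite /C mulFX_weight_idem !mulrA mulH_weight_idem -!scalerAl. Qed.

Lemma cell_mulH S l T : C S l T * H = k (l - (2 * T)%:R) *: C S l T.
Proof.
rewrite /C -mulrA (sl2_muleh HE) mulrA -[_ * _ * (H - _)]mulrA.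
by rewrite (eigenrBn _ (weight_idem_mulH l)) -scalerAr -scalerAl Fp_emb_subn.
Qed.

Lemma mulE_cell0 l T : E * C 0 l T = C 0 (l + 2%:R) T.+1.
Proof.
by rewrite /C !expr0 !mul1r mulrA -(expr1 E) mulEX_weight_idem expr1 -mulrA -exprS.
Qed.

Lemma cell0_mulF S l : C S l 0 * F = C S.+1 (l + 2%:R) 0.
Proof.
rewrite /C !expr0 !mulr1 -mulrA exprSr -mulrA.
by have := mulFX_weight_idem (l + 2%:R) 1; rewrite muln1 addrK expr1 => ->.
Qed.

(** In the first term [E] passes through to join [E^T], shifting the weight by 2. In the second it
    has cancelled one [F], and [H - S] acts on [idem l] by a scalar. *)
Lemma mulE_cellS S l T :
  E * C S.+1 l T = C S.+1 (l + 2%:R) T.+1 + cell_coef S l *: C S l T.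
Proof.
rewrite /C !mulrA (sl2_mulef (HF) (EF)) !mulrDl.
congr (_ + _).
  rewrite -[_ * E * _]mulrA.
  have := mulEX_weight_idem l 1; rewrite muln1 expr1 => ->.
  by rewrite [E ^+ T.+1]exprS !mulrA.
rewrite !mulrnAl -[_ * _ * idem l]mulrA (eigenlBn _ (mulH_weight_idem l)) -scalerAr.
by rewrite -scalerAl scalerMnl.
Qed.

Lemma cellS_mulF S l T :
  C S l T.+1 * F = C S.+1 (l + 2%:R) T.+1 + cell_coef T l *: C S l T.
Proof.
rewrite /C -mulrA (sl2_mulef_r (HE) (EF)) !mulrDr.
congr (_ + _).
  rewrite !mulrA -[_ * _ * F]mulrA.
  have := mulFX_weight_idem (l + 2%:R) 1; rewrite muln1 addrK expr1 => <-.
  by rewrite [F ^+ S.+1]exprSr !mulrA.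
rewrite mulrnAr mulrA -[_ * _ * (H - _)]mulrA (eigenrBn _ (weight_idem_mulH l)).
by rewrite -scalerAr -scalerAl scalerMnl.
Qed.

Lemma weight_idem_cell m S l T :
  idem m * C S l T = C S l T *+ (m == l - (2 * S)%:R).
Proof. exact/weight_idem_mull/mulH_cell. Qed.

Lemma cell_weight_idem m S l T :
  C S l T * idem m = C S l T *+ (m == l - (2 * T)%:R).
Proof. exact/weight_idem_mulr/cell_mulH. Qed.

(** * Spanning by the cells, under the assumption that [E], [F] and [H] generate *)

Hypothesis gen_ind : forall P : R -> Prop,
  P 1 -> (forall x y, P x -> P y -> P (x + y)) ->
  (forall (c : K) x, P x -> P (c *: x)) ->
  (forall x, P x -> P (E * x)) -> (forall x, P x -> P (F * x)) ->
  (forall x, P x -> P (H * x)) -> forall x, P x.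

Lemma cell_ind (P : R -> Prop) :
    (forall x y, P x -> P y -> P (x + y)) ->
    (forall (c : K) x, P x -> P (c *: x)) ->
    (forall S l T, (S < p)%N -> (T < p)%N -> P (C S l T)) ->
  forall x, P x.
Proof.
move=> PD PZ PC.
have P0 : P 0.
  rewrite -(scale0r (C 0 0 0)); apply/PZ/PC; exact/prime_gt0/(pcharf_prime charKp).
have {}PC S l T : P (C S l T).
  have [/andP[? ?]|/cell_eq0->//] := boolP ((S < p) && (T < p))%N; exact: PC.
(* The left factor [y] absorbs the generators peeled off [x]; the condition on [y] survives because
   a generator times a cell is a combination of cells. *)
pose Q x := forall y, (forall S l T, P (y * C S l T)) -> P (y * x).
suff QT x : Q x by move=> x; rewrite -[x]mul1r; apply: QT => *; rewrite mul1r.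
apply: gen_ind x.
- move=> y yC; rewrite -sum_cell00 mulr_sumr; elim/big_ind: _ => //.
- move=> x1 x2 Q1 Q2 y yC; rewrite mulrDr; apply: PD; [exact: Q1|exact: Q2].
- by move=> c x1 Q1 y yC; rewrite -scalerAr; apply/PZ/Q1.
- move=> x1 Q1 y yC; rewrite mulrA; apply: Q1 => -[|S] l T; rewrite -mulrA.
    by rewrite mulE_cell0.
  by rewrite mulE_cellS mulrDr -scalerAr; apply: PD => //; apply: PZ.
- by move=> x1 Q1 y yC; rewrite mulrA; apply: Q1 => S l T; rewrite -mulrA mulF_cell.
- move=> x1 Q1 y yC; rewrite mulrA; apply: Q1 => S l T.
  by rewrite -mulrA mulH_cell -scalerAr; apply: PZ.
Qed.

Local Notation index := ('I_p * 'F_p * 'I_p)%type.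

Definition tcell (t : index) : R := C t.1.1 t.1.2 t.2.

(** Functionals dual to the cells, which encode their independence; for the enveloping algebra they
    are obtained from the regular module. *)
Variable coord : index -> R -> K.
Hypothesis coordD : forall t x y, coord t (x + y) = coord t x + coord t y.
Hypothesis coordZ : forall t c x, coord t (c *: x) = c * coord t x.
Hypothesis coord_tcell : forall t t', coord t (tcell t') = (t == t')%:R.

Lemma cell_tcell S l T (Sp : (S < p)%N) (Tp : (T < p)%N) :
  C S l T = tcell (Ordinal Sp, l, Ordinal Tp).
Proof. by []. Qed.

Lemma sum_coord_tcell (V : lmodType K) (f : index -> V) t :
  \sum_t' coord t' (tcell t) *: f t' = f t.
Proof.
rewrite (bigD1 t) //= coord_tcell eqxx scale1r big1 ?addr0 // => t' /negPf t'E.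
by rewrite coord_tcell t'E scale0r.
Qed.

Lemma tcell_expand x : x = \sum_t coord t x *: tcell t.
Proof.
elim/cell_ind: x => [x y {1}-> {1}->|c x {1}->|S l T Sp Tp].
- by rewrite -big_split; apply: eq_bigr => t _; rewrite coordD scalerDl.
- by rewrite scaler_sumr; apply: eq_bigr => t _; rewrite coordZ scalerA.
- by rewrite (cell_tcell _ Sp Tp) sum_coord_tcell.
Qed.

Lemma tcell_lin_indep (B : R -> Prop) :
  (forall x, B x -> exists t, x = tcell t) -> lin_indep B.
Proof.
move=> Bt n a v v_inj Bv av0 i.
have [t vi] := Bt _ (Bv i).
have coord0 : coord t 0 = 0 by rewrite -(scale0r (0 : R)) coordZ mul0r.
have : coord t (\sum_(j < n) a j *: v j) = 0 by rewrite av0.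
rewrite (big_morph (coord t) (coordD t) coord0) (bigD1 i) //= coordZ vi.
rewrite coord_tcell eqxx mulr1 big1 ?addr0 // => j ji.
have [t' vj] := Bt _ (Bv j).
rewrite coordZ vj coord_tcell; have [tt'|] := eqVneq t t'; last by rewrite mulr0.
by case/eqP: ji; apply: v_inj; rewrite vi vj tt'.
Qed.

(** * The anti-involution *)

Definition cell_star (x : R) : R := \sum_t coord t x *: C t.2 t.1.2 t.1.1.
Local Notation star := cell_star.

Lemma cell_star_linear : linear star.
Proof.
move=> c x y; rewrite /star scaler_sumr -big_split; apply: eq_bigr => t _.
by rewrite coordD coordZ scalerDl scalerA.
Qed.

HB.instance Definition _ :=
  GRing.isLinear.Build K R R *:%R cell_star cell_star_linear.

Lemma cell_star_cell S l T : star (C S l T) = C T l S.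
Proof.
have [/andP[Sp Tp]|ST] := boolP ((S < p) && (T < p))%N.
  rewrite (cell_tcell _ Sp Tp).
  exact: (sum_coord_tcell (fun t : index => C t.2 t.1.2 t.1.1)).
by rewrite !cell_eq0 ?linear0 // andbC.
Qed.

Lemma cell_star_idem l : star (idem l) = idem l.
Proof. by rewrite -cell00 cell_star_cell. Qed.

Lemma cell_star1 : star 1 = 1.
Proof.
by rewrite -sum_weight_idem linear_sum; apply: eq_bigr => l _;
  apply: cell_star_idem.
Qed.

Lemma cell_star_unique (s : R -> R) : linear s ->
  (forall l (S T : 'I_p), s (C S l T) = C T l S) -> s =1 star.
Proof.
move=> s_lin sC x; pose sl := GRing.isLinear.Build _ _ _ _ s s_lin.
pose sL : {linear R -> R} := HB.pack s sl.
elim/cell_ind: x => [x y sx sy|c x sx|S l T Sp Tp].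
- by rewrite linearD /= -sx -sy; apply: (linearD sL).
- by rewrite linearZ /= -sx; apply: (linearZ_LR sL).
- by rewrite cell_star_cell (sC l (Ordinal Sp) (Ordinal Tp)).
Qed.

Lemma cell_starM : {morph star : x y / x * y >-> y * x}.
Proof.
(* Taking [y = 1] identifies [x'] with [star x], so mere existence suffices, and this can be proved
   by induction on [x] through the generators. *)
suff starM x : exists x', forall y, star (x * y) = star y * x'.
  move=> x y; have [x' xE] := starM x; rewrite xE; congr (_ * _).
  by have := xE 1; rewrite mulr1 cell_star1 mul1r.
have gen g g' : (forall S l T, star (g * C S l T) = C T l S * g') ->
    forall y, star (g * y) = star y * g'.
  move=> gC; elim/cell_ind=> [x1 x2 E1 E2|c x1 E1|S l T _ _].
  - by rewrite mulrDr !linearD /= mulrDl E1 E2.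
  - by rewrite -scalerAr !linearZ /= -scalerAl E1.
  - by rewrite gC cell_star_cell.
have genM g g' x1 : (forall S l T, star (g * C S l T) = C T l S * g') ->
    (exists x', forall y, star (x1 * y) = star y * x') ->
  exists x', forall y, star (g * x1 * y) = star y * x'.
  move=> /gen gE [x' xE]; exists (x' * g') => y.
  by rewrite -mulrA gE xE mulrA.
elim/gen_ind: x => [|x1 x2 [x1' E1] [x2' E2]|c x1 [x1' E1]|x1|x1|x1].
- by exists 1 => y; rewrite mul1r mulr1.
- by exists (x1' + x2') => y; rewrite mulrDl linearD /= mulrDr E1 E2.
- by exists (c *: x1') => y; rewrite -scalerAl linearZ /= -scalerAr E1.
(* Left multiplication by [E] is turned into right multiplication by [F]: both formulas have the
   same coefficient [cell_coef S l]. *)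
- apply: (genM _ F) => -[|S] l T.
    by rewrite mulE_cell0 cell0_mulF cell_star_cell.
  by rewrite mulE_cellS cellS_mulF linearD linearZ /= !cell_star_cell.
- by apply: (genM _ E) => S l T; rewrite mulF_cell cell_mulE cell_star_cell.
- apply: (genM _ H) => S l T.
  by rewrite mulH_cell cell_mulH linearZ /= cell_star_cell.
Qed.

Lemma cell_starK : involutive star.
Proof.
elim/cell_ind=> [x y sx sy|c x sx|S l T _ _].
- by rewrite !linearD /= sx sy.
- by rewrite !linearZ /= sx.
- by rewrite !cell_star_cell.
Qed.

Lemma cell_star_anti_involution : anti_involution star.
Proof.
by split; [exact: cell_star_linear|exact: cell_starM|exact: cell_starK].
Qed.

(** * Verification of the cell axioms *)

Hypothesis p_gt2 : (2 < p)%N.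

Definition triple_datum : cell_datum R :=
  {| cd_X := 'F_p;
     cd_M := @sl2_M p;
     cd_C := fun l (S T : sl2_M l) => C (S : 'I_p) l (T : 'I_p);
     cd_star := star;
     cd_I := 'F_p;
     cd_idem := idem;
     cd_lt := @sl2_lt p;
     cd_eps := @sl2_eps p |}.
Local Notation D := triple_datum.

Let p_prime : prime p := pcharf_prime charKp.

Lemma cd_C_total_tcell (t : {l : 'F_p & (sl2_M l * sl2_M l)%type}) :
  @cd_C_total K R D t = tcell ((tagged t).1, tag t, (tagged t).2).
Proof. by []. Qed.

Lemma tcell_inj : injective tcell.
Proof.
move=> t t' tt'; apply/eqP; have := coord_tcell t t'.
by rewrite -tt' coord_tcell eqxx; case: (t == t') => // /eqP; rewrite oner_eq0.
Qed.

Lemma triple_C_inj : injective (@cd_C_total K R D).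
Proof.
move=> [l [S T]] [l' [S' T']].
by rewrite !cd_C_total_tcell => /tcell_inj [-> -> ->].
Qed.

Lemma triple_C_basis : is_basis (fun x => exists t, x = @cd_C_total K R D t).
Proof.
split=> [|x].
  by apply: tcell_lin_indep => x [t ->]; rewrite cd_C_total_tcell; eexists.
rewrite (tcell_expand x); apply: span_sum => -[[S l] T] _.
apply/spanZ/span_in; pose t : {l : 'F_p & (sl2_M l * sl2_M l)%type} :=
  existT (fun l => (sl2_M l * sl2_M l)%type) l (S, T).
by exists t.
Qed.

(** Of the n factors [E], some m pass through to the right and the other n - m each cancel one [F].
    The exponent [a = S - (n - m)] is described additively to avoid truncated subtraction. *)
Lemma span_EX_cell n S l T :
  span (fun x => exists a m, (a + n = S + m)%N /\
                   x = C a (l + (2 * m)%:R) (T + m)) (E ^+ n * C S l T).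
Proof.
elim: n => [|n IH].
  rewrite mul1r; apply: span_in; exists S, 0%N.
  by rewrite muln0 addr0 !addn0.
rewrite exprS -mulrA; apply: (span_map _ _ IH) => [c x y|_ [a [m [am ->]]]].
  by rewrite mulrDr scalerAr.
have shift b : (b + n = S + m)%N -> exists a' m', (a' + n.+1 = S + m')%N /\
    C b (l + (2 * m)%:R + 2%:R) (T + m).+1 = C a' (l + (2 * m')%:R) (T + m').
  move=> bn; exists b, m.+1; rewrite !addnS bn; split=> //.
  by rewrite -addrA -natrD -mulnSr.
case: a am => [|a] am; first by rewrite mulE_cell0; apply/span_in/shift.
rewrite mulE_cellS; apply: spanD; first exact/span_in/shift.
by apply/spanZ/span_in; exists a, m; rewrite addnS -addSn.
Qed.

Lemma span_le_mul_weight i l S T a :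
  @span_le K R D i l (idem i * a * idem i * C S l T).
Proof.
rewrite -!mulrA weight_idem_cell; have [iE|_] := eqVneq; last first.
  by rewrite mulr0n !mulr0; apply: span0.
have lE : l = i + (2 * S)%:R by rewrite iE subrK.
have XE : idem i * C S l T = C S l T by rewrite weight_idem_cell iE eqxx.
rewrite mulr1n [a]tcell_expand mulr_suml mulr_sumr; apply: span_sum.
move=> [[n m] n'] _; rewrite -scalerAl -scalerAr; apply: spanZ.
(* A second copy of [idem i] is inserted so that the expanded factor is cut down to weight [i] on
   both sides. *)
have -> : idem i * (tcell (n, m, n') * C S l T)
          = idem i * C n m n' * idem i * C S l T by rewrite -{1}XE !mulrA.
rewrite weight_idem_cell; have [inE|_] := eqVneq; last first.
  by rewrite mulr0n !mul0r; apply: span0.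
rewrite mulr1n cell_weight_idem; have [in'E|_] := eqVneq; last first.
  by rewrite mulr0n mul0r; apply: span0.
(* Both weights being [i], one has [m = i + 2n = i + 2n'], and doubling is injective below p. *)
have {n' in'E}-> : nat_of_ord n' = n.
  apply: (Fp_double_inj p_prime p_gt2 (l := i)) => //.
  by rewrite {1}in'E inE !subrK.
have -> : C n m n *+ true * C S l T
          = F ^+ n * (idem m * (E ^+ n * C S l T)) by rewrite mulr1n {1}/C -!mulrA.
apply: (span_map (g := fun x => F ^+ n * (idem m * x)) _ _
         (span_EX_cell n S l T)) => [c x y|_ [b [d [bd ->]]]].
  by rewrite !mulrDr !scalerAr.
rewrite weight_idem_cell; have [_|_] := eqVneq; last by rewrite mulr0; apply: span0.
rewrite -cell_addl addnC bd.
(* As [l] has position [S] in the order of [i], a nonzero cell satisfies exactly the bound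
   [S + d < p] under which [l + 2d] lies at or below [l]. *)
have [/andP[Sd Td]|/cell_eq0->] := boolP ((S + d < p) && (T + d < p))%N;
  last exact: span0.
apply: span_in; exists (l + (2 * d)%:R), (Ordinal Sd), (Ordinal Td); split=> //.
case: d Sd {bd Td} => [|d] Sd; first by left; rewrite muln0 addr0.
by right; apply: (sl2_lt_shift lE).
Qed.

(** Only [a * C S l 0] is expanded, and [E^T] is multiplied on afterwards, so the coefficients
    cannot depend on [T]. Since [C S l 0] ends in [idem l], only terms of right weight [l]
    remain. *)
Lemma mul_cell_expand a S l T :
  a * C S l T = \sum_t (coord t (a * C S l 0) *:
    (C t.1.1 t.1.2 (t.2 + T)%N *+ (l == t.1.2 - (2 * t.2)%:R))).
Proof.
have -> : a * C S l T = a * C S l 0 * idem l * E ^+ T.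
  rewrite -[a * _ * idem l]mulrA cell_weight_idem muln0 subr0 eqxx mulr1n.
  by rewrite -[RHS]mulrA -cell_addr.
rewrite {1}[a * _]tcell_expand !mulr_suml; apply: eq_bigr => t _.
by rewrite -!scalerAl cell_weight_idem mulrnAl cell_addr.
Qed.

Let p_gt0 : (0 < p)%N := prime_gt0 p_prime.

Lemma mul_cell a l (S T : 'I_p) : exists y,
  @span_lt K R D (l - (2 * T)%:R) l y /\
  a * C S l T = \sum_(S' : 'I_p)
     coord (S', l, Ordinal p_gt0) (a * C S l 0) *: C S' l T
   + y * idem (l - (2 * T)%:R).
Proof.
(* The terms in [P] make up the sum over [S']; all others form the lower remainder. *)
pose P (t : index) := (t.1.2 == l) && (t.2 == Ordinal p_gt0).
exists (\sum_(t | ~~ P t) (coord t (a * C S l 0) *: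
    (C t.1.1 t.1.2 (t.2 + T)%N *+ (l == t.1.2 - (2 * t.2)%:R)))).
split.
  apply: span_sum => -[[S' m] T'] /= Pt; apply: spanZ.
  have [lE|_] := eqVneq; last exact: span0.
  have [TT|] := boolP (T' + T < p)%N; last first.
    by move=> TT; rewrite mulr1n cell_eq0 ?negb_and ?TT ?orbT //; apply: span0.
  apply: span_in; exists m, S', (Ordinal TT); split=> //.
  have -> : m = l + (2 * T')%:R by rewrite lE subrK.
  (* In the order of [l - 2T] the element [l] has position [T]. The shift [T'] is positive, as
     [T' = 0] would force [m = l] and put the term in [P]. *)
  apply: (sl2_lt_shift (a := T)); rewrite ?subrK // 1?addnC //.
  rewrite lt0n; apply: contraNneq Pt => T'0; rewrite /P /= lE T'0 muln0 subr0.
  by rewrite eqxx; apply/eqP/val_inj.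
rewrite mul_cell_expand (bigID P) /=; congr (_ + _).
  rewrite (reindex_onto (fun S' => (S', l, Ordinal p_gt0)) (fun t => t.1.1)) /=.
    apply: eq_big => S'; first by rewrite /P /= !eqxx.
    by move=> _; rewrite /= muln0 subr0 eqxx.
  by move=> [[S' m] T'] /andP[/= /eqP-> /eqP->].
(* Each remaining term has right weight [m - 2(T' + T) = l - 2T], hence absorbs the idempotent. *)
rewrite mulr_suml; apply: eq_bigr => -[[S' m] T'] _ /=.
rewrite -scalerAl mulrnAl cell_weight_idem; congr (_ *: _).
have [->|//] := eqVneq l; rewrite mulnDr natrD opprD addrA eqxx.
by rewrite mulr1n.
Qed.

Lemma idem_neq0 l : idem l != 0.
Proof.
apply/eqP => idem0.
pose t : index := (Ordinal p_gt0, l, Ordinal p_gt0).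
have := coord_tcell t t.
rewrite /tcell /= cell00 idem0 eqxx => /eqP.
by rewrite -(scale0r (0 : R)) coordZ mul0r eq_sym oner_eq0.
Qed.

Lemma triple_relative_cellular : relative_cellular D.
Proof.
split=> /=.
- by move=> l; rewrite card_ord.
- exact: triple_C_inj.
- exact: triple_C_basis.
- exact: cell_star_anti_involution.
- by move=> l S T; apply: cell_star_cell.
- exact: idem_neq0.
- by move=> l; rewrite weight_idemM eqxx.
- by move=> l m /eqP lm; rewrite weight_idemM (negPf lm).
- exact: cell_star_idem.
- by move=> l; case: (sl2_lt_total p_prime p_gt2 l).
- by move=> l S T i a; apply: span_le_mul_weight.
- by move=> l S T; rewrite weight_idem_cell eqxx.
- by move=> l S T i /eqP; rewrite eq_sym weight_idem_cell => /negPf->.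
- exists (fun a l S' S => coord (S', l, Ordinal p_gt0) (a * C (S : 'I_p) l 0)).
  by move=> l S T a; apply: mul_cell.
Qed.

End RestrictedTriple.

(** * Universal property of the restricted enveloping algebra *)

Section Lift.
Variables (K : fieldType) (R : algType K) (e f h : R).

(** Index 2 lies beyond the list and receives the default value [h]. *)
Definition free3_gen (i : 'I_3) : R := nth h [:: e; f] i.

Definition free3_word (m : {fmonom 'I_3}) : R :=
  \prod_(i <- (m : seq 'I_3)) free3_gen i.

Lemma free3_word_mmorphism : mmorphism free3_word.
Proof.
by split=> [x y|]; rewrite /free3_word ?fmM ?big_cat // fm1 big_nil.
Qed.

HB.instance Definition _ :=
  isMultiplicative.Build _ R free3_word free3_word_mmorphism.

Definition free3_eval (g : free3 K) : R := mmap (in_alg R) free3_word g.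

Lemma free3_evalZ c x : free3_eval (c *: x) = c *: free3_eval x.
Proof. by rewrite /free3_eval mmapZ /= mulr_algl. Qed.

Lemma free3_eval_monoid_morphism : monoid_morphism free3_eval.
Proof.
have [|evalM eval1] := @commr_mmap_is_multiplicative _ K R (in_alg R) free3_word.
  by move=> g m m'; rewrite /GRing.comm /= mulr_algl mulr_algr.
by split.
Qed.

HB.instance Definition _ := GRing.isZmodMorphism.Build (free3 K) R free3_eval
  (raddfB (mmap (in_alg R) free3_word)).
HB.instance Definition _ := GRing.isMonoidMorphism.Build (free3 K) R free3_eval
  free3_eval_monoid_morphism.

Lemma free3_eval_gen i : free3_eval << @fmu 'I_3 i >> = free3_gen i.
Proof.
by rewrite /free3_eval mmapU /= scale1r mul1r /free3_word fmU big_seq1.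
Qed.

Lemma free3_evalE : ((free3_eval (Defs.freeE K) = e) *
  (free3_eval (freeF K) = f) * (free3_eval (freeH K) = h))%type.
Proof. by rewrite !free3_eval_gen. Qed.

Variable p : nat.
Hypotheses (he : h * e - e * h = 2%:R * e) (hf : h * f - f * h = - (2%:R * f)).
Hypotheses (ef : e * f - f * e = h) (ep : e ^+ p = 0) (fp : f ^+ p = 0).
Hypothesis hp : h ^+ p = h.

Lemma free3_eval_ideal x : sl2_ideal p x -> free3_eval x = 0.
Proof.
elim=> {x} [r||x y _ x0 _ y0|a x _ x0|a x _ x0].
- case.
  + by rewrite rmorph_commB rmorph_2M /= !free3_evalE he subrr.
  + by rewrite rmorph_commD rmorph_2M /= !free3_evalE hf addNr.
  + by rewrite rmorph_commB /= !free3_evalE ef subrr.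
  + by rewrite rmorphXn /= free3_evalE ep.
  + by rewrite rmorphXn /= free3_evalE fp.
  + by rewrite rmorph_expB /= free3_evalE hp subrr.
- exact: rmorph0.
- by rewrite rmorphD /= x0 y0 addr0.
- by rewrite rmorphM /= x0 mulr0.
- by rewrite rmorphM /= x0 mul0r.
Qed.

Variable charKp : p \in [pchar K].
Local Notation u := (usl2 charKp).

Lemma usl2_lift : exists rho : u -> R,
  [/\ linear rho, monoid_morphism rho &
      [/\ rho (uE charKp) = e, rho (uF charKp) = f & rho (uH charKp) = h]].
Proof.
exists (fun x => free3_eval (repr x)).
(* Evaluation kills the ideal, so it does not see the choice of representative. *)
have rho_pi x : free3_eval (repr (usl2_pi charKp x)) = free3_eval x.
  by apply: subr0_eq; rewrite -rmorphB; apply/free3_eval_ideal/usl2_repr.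
split; last by rewrite !rho_pi !free3_evalE.
- move=> c; elim/usl2_ind=> x; elim/usl2_ind=> y.
  rewrite -[\pi_u x]/(usl2_pi charKp x) -[\pi_u y]/(usl2_pi charKp y).
  by rewrite -linearP !rho_pi rmorphD /= free3_evalZ.
split=> [|]; first by rewrite -[1 in LHS]/(usl2_pi charKp 1) rho_pi rmorph1.
elim/usl2_ind=> x; elim/usl2_ind=> y.
rewrite -[\pi_u x]/(usl2_pi charKp x) -[\pi_u y]/(usl2_pi charKp y).
by rewrite -rmorphM !rho_pi rmorphM.
Qed.

End Lift.

Section Usl2Induction.
Variables (K : fieldType) (p : nat) (charKp : p \in [pchar K]).
Local Notation u := (usl2 charKp).
Local Notation E := (uE charKp).
Local Notation F := (uF charKp).
Local Notation H := (uH charKp).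

(** A representative is a linear combination of words, and each word is built by adding letters on
    the left. *)
Lemma usl2_gen_ind (P : u -> Prop) :
    P 1 -> (forall x y, P x -> P y -> P (x + y)) ->
    (forall (c : K) x, P x -> P (c *: x)) ->
    (forall x, P x -> P (E * x)) -> (forall x, P x -> P (F * x)) ->
    (forall x, P x -> P (H * x)) ->
  forall x, P x.
Proof.
move=> P1 PD PZ PE PF PH; elim/usl2_ind=> x.
rewrite -[\pi_u x]/(usl2_pi charKp x) (monalgE x) raddf_sum.
have P0 : P 0 by rewrite -(scale0r 1); apply: PZ.
elim/big_ind: _ => // m _.
have -> : << x@_m *g m >> = x@_m *: << m >> :> free3 K.
  by apply/malgP => k; rewrite mcoeffZ !mcoeffU mulrnAr mulr1.
rewrite /= usl2_pi_is_scalable; apply: PZ; case: m => s.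
elim: s => [|i s IHs]; first by rewrite -fmoneE (rmorph1 (usl2_pi charKp)).
have -> : << FMonom (i :: s) >> = << @fmu 'I_3 i >> * << FMonom s >> :> free3 K.
  rewrite malgM_def fgmulUU mulr1; congr << _ >>.
  by apply/eqP; rewrite fmP fmM fmU.
rewrite rmorphM /=.
case: i => [[|[|[|i]]] i_lt3] //.
- rewrite (_ : Ordinal _ = Ordinal (isT : (0 < 3)%N)); first exact: PE.
  exact: val_inj.
- rewrite (_ : Ordinal _ = Ordinal (isT : (1 < 3)%N)); first exact: PF.
  exact: val_inj.
- rewrite (_ : Ordinal _ = Ordinal (isT : (2 < 3)%N)); first exact: PH.
  exact: val_inj.
Qed.

End Usl2Induction.

(** * The right regular module *)

Section RegularModule.
Variables (K : fieldType) (p : nat) (charKp : p \in [pchar K]).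
Local Notation k := (Fp_emb charKp).
Local Notation V := {ffun 'F_p * 'F_p * 'F_p -> K^o}.

Let p_prime : prime p := pcharf_prime charKp.

(* The point (S, l, T) stands for F^S 1_l E^T; the operators are the right
   multiplications by E, F and H, written on coordinates. *)
Definition reg_E (f : V) : V :=
  [ffun t => if t.2 == 0 then 0 else f (t.1.1, t.1.2, t.2 - 1)].

(** The scalar [(T+1)(l-T)] is [cell_coef T l]. It vanishes when [T + 1] wraps around to 0, so no
    spurious term appears at the boundary. *)
Definition reg_F (f : V) : V :=
  [ffun t => (if t.1.1 == 0 then 0 else f (t.1.1 - 1, t.1.2 - 2%:R, t.2))
    + k ((t.2 + 1) * (t.1.2 - t.2)) * f (t.1.1, t.1.2, t.2 + 1)].

Definition reg_H (f : V) : V := [ffun t => k (t.1.2 - 2%:R * t.2) * f t].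

Lemma reg_E_linear : linear reg_E.
Proof.
move=> c f g; apply/ffunP => t; rewrite !ffunE.
by case: ifP; rewrite ?scaler0 ?addr0.
Qed.

Lemma reg_F_linear : linear reg_F.
Proof.
move=> c f g; apply/ffunP => t; rewrite !ffunE mulrDr scalerDr addrACA scalerAr.
by congr (_ + _); case: ifP; rewrite ?scaler0 ?addr0.
Qed.

Lemma reg_H_linear : linear reg_H.
Proof. by move=> c f g; apply/ffunP => t; rewrite !ffunE mulrDr scalerAr. Qed.

HB.instance Definition _ :=
  GRing.isLinear.Build K V V *:%R reg_E reg_E_linear.
HB.instance Definition _ :=
  GRing.isLinear.Build K V V *:%R reg_F reg_F_linear.
HB.instance Definition _ :=
  GRing.isLinear.Build K V V *:%R reg_H reg_H_linear.

Lemma reg_proper : (0 < dim V)%N.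
Proof. 
rewrite -dimvf lt0n dimv_eq0 -subv0.
apply/negP => /subvP /(_ [ffun => 1] (memvf _)).
rewrite memv0 => /eqP/ffunP/(_ (0, 0, 0)).
by rewrite !ffunE => /eqP; rewrite oner_eq0.
Qed.

(* In [lfun_algType] the product [x * y] is [y \o x]: [V] is a right module. *)
Definition reg_alg : algType K := lfun_algType reg_proper.

Definition reg_act (x : reg_alg) : V -> V := fun_of_lfun (x : 'End(V)).

Lemma reg_actM (x y : reg_alg) v : reg_act (x * y) v = reg_act y (reg_act x v).
Proof. exact: comp_lfunE. Qed.
Lemma reg_act1 v : reg_act 1 v = v.
Proof. exact: id_lfunE. Qed.
Lemma reg_actD (x y : reg_alg) v : reg_act (x + y) v = reg_act x v + reg_act y v.
Proof. exact: add_lfunE. Qed.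
Lemma reg_actN (x : reg_alg) v : reg_act (- x) v = - reg_act x v.
Proof. exact: opp_lfunE. Qed.
Lemma reg_actZ c (x : reg_alg) v : reg_act (c *: x) v = c *: reg_act x v.
Proof. exact: scale_lfunE. Qed.
Lemma reg_act_linear x : linear (reg_act x).
Proof. by move=> c u v; rewrite /reg_act linearP. Qed.
HB.instance Definition _ x :=
  GRing.isLinear.Build K V V *:%R (reg_act x) (reg_act_linear x).

Lemma reg_actP (x y : reg_alg) : (forall v, reg_act x v = reg_act y v) -> x = y.
Proof. by move=> xy; apply/lfunP. Qed.

Definition rE : reg_alg := linfun reg_E : 'End(V).
Definition rF : reg_alg := linfun reg_F : 'End(V).
Definition rH : reg_alg := linfun reg_H : 'End(V).

Lemma reg_actE v : reg_act rE v = reg_E v. Proof. exact: lfunE. Qed.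
Lemma reg_actF v : reg_act rF v = reg_F v. Proof. exact: lfunE. Qed.
Lemma reg_actH v : reg_act rH v = reg_H v. Proof. exact: lfunE. Qed.

Let actE := (reg_actD, reg_actN, reg_actM, reg_actE, reg_actF, reg_actH).

(* [ring] does not see through the alias [K^o] of the values of [v]. *)
Let ringHE (x : K) (T l : 'F_p) :
  k (l - 2%:R * (T - 1)) * x - k (l - 2%:R * T) * x = x + x.
Proof. by ring. Qed.

Let ringHF (x y : K) (T l : 'F_p) : let c := k ((T + 1) * (l - T)) in
  k (l - 2%:R - 2%:R * T) * x + c * (k (l - 2%:R * (T + 1)) * y)
    - k (l - 2%:R * T) * (x + c * y) = - (x + c * y + (x + c * y)).
Proof. by rewrite /=; ring. Qed.

Let ringEF (x y : K) (T l : 'F_p) :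
  x + k ((T + 1) * (l - T)) * y - (x + k (T * (l - (T - 1))) * y)
  = k (l - 2%:R * T) * y.
Proof. by ring. Qed.

Lemma reg_HE : rH * rE - rE * rH = 2%:R * rE.
Proof.
apply: reg_actP => v; rewrite mulr_natl mulr2n !actE.
apply/ffunP => -[[S l] T]; rewrite !ffunE /=.
case: eqP => _; first by rewrite mulr0 subr0 addr0.
exact: ringHE.
Qed.

Lemma reg_HF : rH * rF - rF * rH = - (2%:R * rF).
Proof.
apply: reg_actP => v; rewrite mulr_natl mulr2n !actE.
apply/ffunP => -[[S l] T]; rewrite !ffunE /=.
case: eqP => _; last exact: ringHF.
by have := ringHF 0 (v (S, l, T + 1)) T l; rewrite /= mulr0 !add0r.
Qed.

Lemma reg_EF : rE * rF - rF * rE = rH.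
Proof.
apply: reg_actP => v; rewrite !actE.
apply/ffunP => -[[S l] T]; rewrite !ffunE /=.
(* The boundary value 0 of [reg_E] is harmless here because the coefficient contains the same factor
   [T + 1]. *)
have -> : k ((T + 1) * (l - T)) * (if T + 1 == 0 then 0 else v (S, l, T + 1 - 1))
          = k ((T + 1) * (l - T)) * v (S, l, T).
  rewrite addrK; case: eqP => // ->.
  by rewrite [0 * (l - T)]mul0r (rmorph0 k) !mul0r.
have [->|_] := eqVneq T 0.
  by case: ifP => _; rewrite ?add0r mul1r mulr0 subr0 subr0.
rewrite !subrK; by case: ifP => _; [exact: (ringEF 0)|exact: ringEF].
Qed.

(** * Basis vectors and the remaining restricted relations *)

Definition delta (S l T : 'F_p) : V := [ffun t => (t == (S, l, T))%:R].

Lemma reg_act_ext (x y : reg_alg) :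
  (forall S l T, reg_act x (delta S l T) = reg_act y (delta S l T)) -> x = y.
Proof.
move=> xy; apply: reg_actP => v.
have -> : v = \sum_t v t *: delta t.1.1 t.1.2 t.2.
  apply/ffunP => t; rewrite sum_ffunE (bigD1 t) //= big1 ?addr0.
    by rewrite !ffunE; case: t => [[S l] T]; rewrite eqxx [RHS]mulr1.
  move=> [[S l] T] /= tt'; rewrite !ffunE eq_sym (negPf tt').
  exact: mulr0.
by rewrite !linear_sum; apply: eq_bigr => t _; rewrite !linearZ /= xy.
Qed.

Lemma reg_act0r x : reg_act x 0 = 0. Proof. exact: linear0. Qed.

Lemma natr_Fp_eq0 n : (n < p)%N -> (n.+1%:R == 0 :> 'F_p) = (n.+1 == p).
Proof.
move=> np; rewrite -(GRing.dvdn_pcharf (pchar_Fp p_prime)).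
apply/idP/eqP => [pn|->//]; apply/eqP; rewrite eqn_leq np; exact: dvdn_leq.
Qed.

Lemma reg_E_delta S l T :
  reg_E (delta S l T) = if T + 1 == 0 then 0 else delta S l (T + 1).
Proof.
apply/ffunP => -[[S' l'] T']; rewrite (fun_if (fun f : V => f _)) !ffunE /=.
rewrite !xpair_eqE subr_eq; have [->|T'0] := eqVneq T' 0.
  by rewrite eq_sym; case: eqP => //; rewrite andbF.
by have [->|//] := eqVneq (T + 1) 0; rewrite (negPf T'0) andbF.
Qed.

(** For [T = 0] the lowering term of [reg_F] could only be nonzero where [T' + 1 = 0], and there its
    coefficient vanishes. *)
Lemma reg_F_delta S l :
  reg_F (delta S l 0) = if S + 1 == 0 then 0 else delta (S + 1) (l + 2%:R) 0.
Proof.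
apply/ffunP => -[[S' l'] T']; rewrite (fun_if (fun f : V => f _)) !ffunE /=.
rewrite !xpair_eqE !subr_eq; have [->|T'1] := eqVneq (T' + 1) 0.
  rewrite [0 * (l' - T')]mul0r (rmorph0 k) mul0r addr0.
  have [->|S'0] := eqVneq S' 0; first by rewrite [0 == _]eq_sym; case: eqP.
  by have [->|//] := eqVneq (S + 1) 0; rewrite (negPf S'0).
rewrite !andbF mulr0 addr0.
have [->|S'0] := eqVneq S' 0; first by rewrite [0 == _]eq_sym; case: eqP.
by have [->|//] := eqVneq (S + 1) 0; rewrite (negPf S'0).
Qed.

Lemma reg_EX_delta n S l :
  reg_act (rE ^+ n) (delta S l 0) = if (n < p)%N then delta S l n%:R else 0.
Proof.
elim: n => [|n IH]; first by rewrite reg_act1 prime_gt0.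
rewrite exprSr reg_actM IH; case: ltnP => [np|pn].
  rewrite reg_actE reg_E_delta natr1 natr_Fp_eq0 //.
  by have [->|nE] := eqVneq n.+1 p; rewrite ?ltnn // ltn_neqAle nE np.
by rewrite reg_act0r ltnNge (leq_trans pn).
Qed.

Lemma reg_FX_delta n l : reg_act (rF ^+ n) (delta 0 l 0)
  = if (n < p)%N then delta n%:R (l + (2 * n)%:R) 0 else 0.
Proof.
elim: n => [|n IH]; first by rewrite reg_act1 prime_gt0 // muln0 addr0.
rewrite exprSr reg_actM IH; case: ltnP => [np|pn].
  rewrite reg_actF reg_F_delta natr1 natr_Fp_eq0 // -addrA -natrD -mulnSr.
  by have [->|nE] := eqVneq n.+1 p; rewrite ?ltnn // ltn_neqAle nE np.
by rewrite reg_act0r ltnNge (leq_trans pn).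
Qed.

Lemma Fp_ltn (a : 'F_p) : (a < p)%N.
Proof. by rewrite -[X in (_ < X)%N](Fp_cast p_prime). Qed.

Lemma delta_E S l (T : 'F_p) : delta S l T = reg_act (rE ^+ T) (delta S l 0).
Proof. by rewrite reg_EX_delta Fp_ltn natr_Zp. Qed.

Lemma delta_F (S l : 'F_p) :
  delta S l 0 = reg_act (rF ^+ S) (delta 0 (l - (2 * S)%:R) 0).
Proof. by rewrite reg_FX_delta Fp_ltn natr_Zp subrK. Qed.

Lemma reg_Ep : rE ^+ p = 0.
Proof.
apply: reg_act_ext => S l T.
rewrite delta_E -reg_actM -exprD addnC exprD reg_actM reg_EX_delta ltnn.
by rewrite !reg_act0r [RHS]zero_lfunE.
Qed.

(** The correction term in the commutation formula carries the factor p, which is 0 in [K]. *)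
Lemma reg_FpE : rF ^+ p * rE = rE * rF ^+ p.
Proof.
have := sl2_mulef reg_HF reg_EF p.-1; rewrite prednK ?prime_gt0 // => ->.
by rewrite -[X in _ + X]scaler_nat pcharf0 // scale0r addr0.
Qed.

Lemma reg_Fp : rF ^+ p = 0.
Proof.
apply: reg_act_ext => S l T.
(* Any basis vector is [delta 0 a 0] acted on by [F^S] and then [E^T]; commuting [F^p] to the front
   applies it first to [delta 0 a 0], where it gives 0. *)
have FpE : rE ^+ T * rF ^+ p = rF ^+ p * rE ^+ T.
  exact/commr_sym/commrX/reg_FpE.
rewrite delta_E -reg_actM FpE reg_actM delta_F -[X in reg_act _ X]reg_actM.
rewrite -exprD addnC exprD reg_actM reg_FX_delta ltnn !reg_act0r.
by rewrite [RHS]zero_lfunE.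
Qed.

(** [rH] is diagonal with entries in the prime field, which the p-th power fixes. *)
Lemma reg_Hp : rH ^+ p - rH = 0.
Proof.
suff -> : rH ^+ p = rH by rewrite subrr.
have HX n v t : reg_act (rH ^+ n) v t = k (t.1.2 - 2%:R * t.2) ^+ n * v t.
  elim: n v => [|n IH] v; first by rewrite reg_act1 mul1r.
  by rewrite exprSr reg_actM reg_actH ffunE IH mulrA -exprS.
by apply: reg_actP => v; apply/ffunP => t; rewrite HX Fp_emb_exp reg_actH ffunE.
Qed.

Lemma reg_H_delta S l T :
  reg_H (delta S l T) = k (l - 2%:R * T) *: delta S l T.
Proof.
apply/ffunP => t; rewrite !ffunE; have [->|] := eqVneq t (S, l, T); first by [].
by move=> _; rewrite mulr0 scaler0.
Qed.

Lemma reg_weight_delta m S l : reg_act (weight_idem rH m) (delta S l 0)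
  = if l == m then delta S l 0 else 0.
Proof.
pose w (a : 'F_p) := reg_act (weight_idem rH a) (delta S l 0).
have w0 a : l != a -> w a = 0.
  move=> la.
  have := congr1 (reg_act^~ (delta S l 0)) (mulH_weight_idem charKp reg_Hp a).
  rewrite reg_actM reg_actH reg_H_delta mulr0 subr0 linearZ reg_actZ /=.
  move/eqP; rewrite -subr_eq0 -scalerBl scaler_eq0 -rmorphB fmorph_eq0 subr_eq0.
  by rewrite (negPf la) => /eqP.
have [<-|/w0//] := eqVneq l m.
have actD0 (f : 'F_p -> reg_alg) : reg_act (\sum_a f a) (delta S l 0)
    = \sum_a reg_act (f a) (delta S l 0).
  apply: (big_morph (reg_act^~ (delta S l 0))) => [x y|]; last exact: zero_lfunE.
  exact: reg_actD.
rewrite -[RHS]reg_act1 -(sum_weight_idem charKp rH) actD0 (bigD1 l) //=.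
by rewrite big1 ?addr0 // => a al; apply: w0; rewrite eq_sym.
Qed.

Lemma reg_cell (S : nat) l (T : nat) : (S < p)%N -> (T < p)%N ->
  reg_act (cell rE rF rH S l T) (\sum_a delta 0 a 0) = delta S%:R l T%:R.
Proof.
move=> Sp Tp; rewrite /cell !reg_actM !linear_sum /=.
(* [F^S] raises the middle index from [a] to [a + 2S], and the idempotent keeps only the summand
   with [a + 2S = l]. *)
rewrite (bigD1 (l - (2 * S)%:R)) //= reg_FX_delta Sp reg_weight_delta subrK eqxx.
rewrite reg_EX_delta Tp big1 ?addr0 // => a al.
rewrite reg_FX_delta Sp reg_weight_delta eq_sym -subr_eq eq_sym.
by rewrite (negPf al) reg_act0r.
Qed.

End RegularModule.

(** * Dual coordinates on the restricted enveloping algebra *)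

Section Coordinates.
Variables (K : fieldType) (p : nat) (charKp : p \in [pchar K]).
Local Notation u := (usl2 charKp).
Local Notation E := (uE charKp).
Local Notation F := (uF charKp).
Local Notation H := (uH charKp).

Lemma usl2_coord : exists coord : 'I_p * 'F_p * 'I_p -> u -> K,
  [/\ forall t x y, coord t (x + y) = coord t x + coord t y,
      forall t c x, coord t (c *: x) = c * coord t x &
      forall t t', coord t (tcell E F H t') = (t == t')%:R].
Proof.
have p_prime := pcharf_prime charKp.
have [rho [rho_lin rho_mon [rhoE rhoF rhoH]]] := usl2_lift (reg_HE charKp)
  (reg_HF charKp) (reg_EF charKp) (reg_Ep charKp) (reg_Fp charKp)
  (subr0_eq (reg_Hp charKp)) charKp.
pose rhoL := GRing.isLinear.Build _ _ _ _ rho rho_lin.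
pose rhoM := GRing.isMonoidMorphism.Build _ _ rho rho_mon.
pose rhoR : {lrmorphism u -> reg_alg K p} := HB.pack rho rhoL rhoM.
have rho_idem (l : 'F_p) :
    rho (weight_idem H l) = weight_idem (rH charKp) l.
  rewrite -[LHS]/(rhoR _) rmorphN rmorph_prod; congr (- _); apply: eq_bigr => a _.
  by rewrite rmorphB rmorph_nat /= rhoH.
have rho_cell S (l : 'F_p) T : rhoR (cell E F H S l T)
    = cell (rE K p) (rF charKp) (rH charKp) S l T.
  by rewrite !rmorphM !rmorphXn /= rhoE rhoF rho_idem.
have natr_eq (i j : 'I_p) : ((i : nat)%:R == (j : nat)%:R :> 'F_p) = (i == j).
  by apply/eqP/eqP => [/(Fp_natr_inj p_prime (ltn_ord i) (ltn_ord j))/val_inj|->].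
exists (fun (t : 'I_p * 'F_p * 'I_p) x => reg_act (rhoR x) (\sum_a delta K 0 a 0)
  ((t.1.1 : nat)%:R, t.1.2, (t.2 : nat)%:R)); split.
- by move=> t x y; rewrite rmorphD reg_actD ffunE.
- by move=> t c x; rewrite linearZ reg_actZ ffunE.
move=> [[S l] T] [[S' l'] T']; rewrite rho_cell reg_cell // ffunE /=.
by rewrite !xpair_eqE !natr_eq.
Qed.

End Coordinates.

Theorem theorem4p10 (K : fieldType) (p : nat) (charKp : p \in [pchar K])
    (p_gt2 : (2 < p)%N) :
  (forall l : 'F_p, strict_total_order (@sl2_lt p l)) /\
  (exists star : usl2 charKp -> usl2 charKp,
     unique (fun s => anti_involution s /\
               forall (l : 'F_p) (S T : 'I_p),
                 s (uF charKp ^+ S * u_idem charKp l * uE charKp ^+ T) =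
                 uF charKp ^+ T * u_idem charKp l * uE charKp ^+ S) star /\
     relative_cellular (sl2_datum star)).
Proof.
have p_prime := pcharf_prime charKp.
split; first by move=> l; apply: sl2_lt_total.
have [coord [coordD coordZ coord_tcell]] := usl2_coord charKp.
have gen_ind := @usl2_gen_ind K p charKp.
exists (cell_star (uE charKp) (uF charKp) (uH charKp) coord); split.
  split.
    split; first by apply: (cell_star_anti_involution charKp (uHE charKp)
      (uHF charKp) (uEF charKp) (uEp charKp) (uFp charKp) (uHp charKp) gen_ind).
    move=> l S T.
    exact: (cell_star_cell (uEp charKp) (uFp charKp) coordD coordZ coord_tcell).
  (* A linear map is determined by its values on the spanning cells. *)
  move=> s [[s_lin _ _] sC]; apply/funext => x; symmetry.
  exact: (cell_star_unique charKp (uHE charKp)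
      (uHF charKp) (uEF charKp) (uEp charKp) (uFp charKp) (uHp charKp) gen_ind
      coordD coordZ coord_tcell s_lin sC).
exact: (triple_relative_cellular charKp (uHE charKp)
      (uHF charKp) (uEF charKp) (uEp charKp) (uFp charKp) (uHp charKp) gen_ind
      coordD coordZ coord_tcell p_gt2).
Qed.
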